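(* Let $G$ be a finite abelian group and $H$ a subgroup of $G$ with $1<|H|<|G|$. Let $m_2$ be the number of cosets $H+a$ of $H$ in $G$ such that $2a\in H$ but $H+a$ contains no solution of $2x=0$. Then the domination number of $\Gamma^+_{G,H}$ is $|G:H|$, and the domination number of $\Gamma_{G,H}$ is $|G:H|+m_2$.
   Context: Groups are written additively with identity $0$. For a finite abelian group $G$ and a subgroup $H$, $\Gamma^+_{G,H}$ is the simple graph with vertex set $G$ in which distinct $x,y$ are adjacent iff $x+y\in H$; $\Gamma_{G,H}$ is the simple graph with vertex set $G$ in which distinct $x,y$ are adjacent iff $x+y\in H\setminus\{0\}$. The domination number of a graph is the least cardinality of a set of vertices for which the union of their closed neighbourhoods (each vertex together with its neighbours) is the whole vertex set. *)

(* Defs.v *)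
From mathcomp Require Import all_boot all_order all_algebra all_fingroup.

Set Implicit Arguments.
Unset Strict Implicit.
Unset Printing Implicit Defensive.

Import GRing.Theory.
Local Open Scope ring_scope.

Section Domination.
Variables (V : finType) (e : rel V).

Definition closed_nbhd (x : V) : {set V} := [set y | (y == x) || e x y].

Definition dominating (D : {set V}) : bool :=
  \bigcup_(x in D) closed_nbhd x == [set: V].

(* The default [set: V] of the minimum is always dominating: a vertex lies in
   its own closed neighbourhood. *)
Definition domination_number : nat :=
  #|[arg min_(D < [set: V] | dominating D) #|D|]|.

Lemma dominatingT : dominating [set: V].
Proof.
apply/eqP/setP=> x; rewrite !inE; apply/bigcupP.
by exists x; rewrite ?inE ?eqxx.
Qed.

End Domination.

(* A finZmodType G is canonically a finGroupType whose group law is addition,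
   so a {group G} is a subgroup of (G, +), and (H :* a)%g is the coset H + a. *)

Definition sum_graph (G : finZmodType) (H : {group G}) : rel G :=
  fun x y => (x != y) && (x + y \in H).

Definition sum_graph_nz (G : finZmodType) (H : {group G}) : rel G :=
  fun x y => (x != y) && (x + y \in H :\ 0).

Lemma sum_graph_simple (G : finZmodType) (H : {group G}) :
  symmetric (sum_graph H) /\ irreflexive (sum_graph H).
Proof.
by split=> [x y | x]; rewrite /sum_graph ?eqxx // eq_sym addrC.
Qed.

Lemma sum_graph_nz_simple (G : finZmodType) (H : {group G}) :
  symmetric (sum_graph_nz H) /\ irreflexive (sum_graph_nz H).
Proof.
by split=> [x y | x]; rewrite /sum_graph_nz ?eqxx // eq_sym addrC.
Qed.

(* An image set of cosets, so its cardinal counts cosets, not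
   representatives a. *)
Definition m2 (G : finZmodType) (H : {group G}) : nat :=
  #|[set (H :* a)%g | a : G
      & (a *+ 2 \in H) && ~~ [exists x in (H :* a)%g, x *+ 2 == 0]]|.

(* Main.v *)
Require Import Defs.
From mathcomp Require Import all_boot all_order all_algebra all_fingroup.

(** Split G into the cosets C = H + a.  Two vertices can only be adjacent when
    one lies in C and the other in -C for some C, so both domination numbers
    are sums of local contributions: C contributes w(C) = 1, or w(C) = 2 for
    the second graph when C is one of the cosets counted by m2.

    Lower bound.  A dominating set D may miss a coset C <> -C, but then -C can
    only be dominated by itself and D contains -C, which has at least two
    elements.  Hence what holds for every C is the symmetrised inequality
    2 w(C) <= #|D :&: C| + #|D :&: -C| ([dominating_two],
    [dominating_nz_coset]), and summing it over all cosets counts each element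
    of D twice ([weight_le_card]).

    Upper bound.  For the first graph a transversal of the cosets is
    dominating ([dominating_repr]).  For the second graph, one element q is
    chosen in each set C :|: -C, with 2q = 0 if possible, and D consists of all
    the elements q and -q.  As D = -D meets every coset, a vertex y has
    some x in D with x + y in H, and if x + y = 0 then y = -x is itself in D
    ([dominating_sym_repr]).  The two elements q and -q lie in the same coset
    and are distinct exactly for the cosets counted by m2
    ([card_sym_repr_coset]). *)

Set Implicit Arguments.
Unset Strict Implicit.
Unset Printing Implicit Defensive.

Import GRing.Theory.
Local Open Scope ring_scope.

(** * Dominating sets *)

Lemma dominatingP (V : finType) (e : rel V) (D : {set V}) :
  reflect (forall y, exists2 x, x \in D & (y == x) || e x y) (dominating e D).
Proof.
apply: (iffP eqP) => [eqT y | domD].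
  have : y \in [set: V] by rewrite inE.
  by rewrite -eqT => /bigcupP[x xD]; rewrite inE; exists x.
apply/setP=> y; rewrite [RHS]inE; apply/bigcupP.
by have [x xD xy] := domD y; exists x; rewrite // inE.
Qed.

Lemma domination_number_eq (V : finType) (e : rel V) (n : nat) (D : {set V}) :
    dominating e D -> (#|D| <= n)%N ->
    (forall A, dominating e A -> (n <= #|A|)%N) ->
  domination_number e = n.
Proof.
move=> domD leDn minn; rewrite /domination_number.
case: arg_minnP => [|A domA minA]; first exact: dominatingT.
by apply/eqP; rewrite eqn_leq minn // (leq_trans (minA _ domD)).
Qed.

(** * Cosets and negation *)

Section Cosets.

Variables (G : finZmodType) (H : {group G}).
Implicit Types (a x y : G) (D C : {set G}).

Lemma mem_addcoset a y : (y \in (H :* a)%g) = (y - a \in H).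
Proof. by rewrite mem_rcoset. Qed.

Lemma subgN x : (- x \in H) = (x \in H).
Proof. exact: groupV. Qed.

Lemma addcoset_eqP a y : reflect ((H :* y)%g = (H :* a)%g) (y - a \in H).
Proof.
rewrite -mem_addcoset; apply: (iffP idP) => [/rcoset_eqP // | <-].
exact: rcoset_refl.
Qed.

Lemma addcoset_oppE a : (a *+ 2 \in H) = ((H :* a)%g == (H :* (- a))%g).
Proof. by rewrite mulr2n -{2}(opprK a); apply/addcoset_eqP/eqP. Qed.

Lemma mem_addcoset_opp a x : (x \in (H :* (- a))%g) = (- x \in (H :* a)%g).
Proof. by rewrite !mem_addcoset opprK -subgN opprD. Qed.

Lemma addcoset_opp_congr a b :
  (H :* a)%g = (H :* b)%g -> (H :* (- a))%g = (H :* (- b))%g.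
Proof. by move=> eqab; apply/setP=> x; rewrite !mem_addcoset_opp eqab. Qed.

Lemma card_addcosets D :
  #|D| = (\sum_(C in rcosets H [set: G]) #|D :&: C|)%N.
Proof.
rewrite -sum1_card (partition_big (fun x => (H :* x)%g)
  (mem (rcosets H [set: G]))) /= => [|x _]; last first.
  by apply/rcosetsP; exists x; rewrite ?inE.
apply: eq_bigr => _ /rcosetsP[a _ ->]; rewrite -sum1_card.
apply: eq_bigl => x; rewrite inE; congr andb.
by rewrite mem_addcoset; apply/eqP/addcoset_eqP.
Qed.

Lemma mem_oppset x C : (x \in [set - y | y in C]) = (- x \in C).
Proof. by rewrite -[X in X \in imset _ _]opprK (mem_imset _ _ oppr_inj). Qed.

Lemma sum_addcosets_opp (F : {set G} -> nat) :
  (\sum_(C in rcosets H [set: G]) F C =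
   \sum_(C in rcosets H [set: G]) F [set (- x)%R | x in C])%N.
Proof.
pose N C := [set - x | x in C].
have NK : involutive N by move=> C; apply/setP=> x; rewrite !mem_oppset opprK.
rewrite (reindex_inj (inv_inj NK)); apply: eq_bigl => C.
have memN B : B \in rcosets H [set: G] -> N B \in rcosets H [set: G].
  case/rcosetsP=> a _ ->; apply/rcosetsP; exists (- a); rewrite ?inE //.
  by apply/setP=> x; rewrite mem_addcoset_opp mem_oppset.
by apply/idP/idP=> [/memN|/memN //]; rewrite NK.
Qed.

(** A coset inequality symmetrised over C and -C sums to a lower bound on the
    cardinal, since negation permutes the cosets. *)
Lemma weight_le_card (w : {set G} -> nat) D :
    (forall a, 2 * w (H :* a)%g <=
       #|D :&: (H :* a)%g| + #|D :&: (H :* (- a))%g|)%N ->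
  (\sum_(C in rcosets H [set: G]) w C <= #|D|)%N.
Proof.
move=> le2w; rewrite -(leq_pmul2l (isT : (0 < 2)%N)).
rewrite [leqRHS]mul2n -addnn {1}card_addcosets (card_addcosets D).
rewrite [X in (_ <= _ + X)%N]sum_addcosets_opp -big_split big_distrr /=.
apply: leq_sum => _ /rcosetsP[a _ ->].
suff <- : (H :* (- a))%g = [set - x | x in (H :* a)%g] by [].
by apply/setP=> x; rewrite mem_addcoset_opp mem_oppset.
Qed.

(** * Lower bounds *)

Section LowerBound.

Variables (e : rel G) (D : {set G}).
Hypothesis e_sub : forall x y, e x y -> x + y \in H.
Hypothesis domD : dominating e D.

Lemma dominator a : a \in D \/ exists2 x, x \in D & x \in (H :* (- a))%g.
Proof.
have /dominatingP/(_ a)[x xD /predU1P[->|/e_sub xaH]] := domD; first by left.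
by right; exists x; rewrite // mem_addcoset opprK.
Qed.

(** If D misses C then D contains -C. *)
Lemma dominating_miss a :
  D :&: (H :* a)%g = set0 -> (H :* (- a))%g \subset D.
Proof.
move=> Da0; apply/subsetP=> y yNa; have [//|[x xD xNy]] := dominator y.
suff : x \in D :&: (H :* a)%g by rewrite Da0 inE.
rewrite inE xD; rewrite mem_addcoset_opp in yNa.
by rewrite -(rcoset_eqP yNa).
Qed.

Lemma dominating_two a : (1 < #|H|)%N ->
  (2 <= #|D :&: (H :* a)%g| + #|D :&: (H :* (- a))%g|)%N.
Proof.
move=> H_gt1.
have miss b : D :&: (H :* b)%g = set0 -> (1 < #|D :&: (H :* (- b))%g|)%N.
  by move/dominating_miss/setIidPr->; rewrite card_rcoset.
have [/miss gt1|Da0] := eqVneq (D :&: (H :* a)%g) set0.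
  exact: leq_trans gt1 (leq_addl _ _).
have [/miss gt1|DNa0] := eqVneq (D :&: (H :* (- a))%g) set0.
  by rewrite opprK in gt1; apply: leq_trans gt1 (leq_addr _ _).
by rewrite -!card_gt0 in Da0 DNa0; rewrite (leq_add Da0 DNa0).
Qed.

End LowerBound.

Lemma sum_graph_sub x y : sum_graph H x y -> x + y \in H.
Proof. by case/andP. Qed.

Lemma sum_graph_nz_sub x y : sum_graph_nz H x y -> x + y \in H.
Proof. by case/andP=> _ /setD1P[]. Qed.

(** The cosets C = -C without a solution of 2x = 0, which m2 counts. *)
Definition m2_cosets : {set {set G}} :=
  [set (H :* a)%g | a : G
     & (a *+ 2 \in H) && ~~ [exists x in (H :* a)%g, x *+ 2 == 0]].

Lemma mem_m2_cosets a : ((H :* a)%g \in m2_cosets) =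
  (a *+ 2 \in H) && ~~ [exists x in (H :* a)%g, x *+ 2 == 0].
Proof.
apply/imsetP/idP=> [[b] | Pa]; last by exists a; rewrite ?inE.
rewrite inE !addcoset_oppE => Pb eqab.
by rewrite (addcoset_opp_congr eqab) eqab.
Qed.

(** The weights 1 and 2 of the cosets add up to the second domination number. *)
Lemma sum_m2_weight :
  (\sum_(C in rcosets H [set: G]) (1 + (C \in m2_cosets)) =
   #|[set: G] : H|%g + m2 H)%N.
Proof.
rewrite big_split /= sum1_card; congr addn.
rewrite /m2 -/m2_cosets -[RHS]sum1_card big_mkcond [RHS]big_mkcond /=.
apply: eq_bigr => C _; case: (boolP (C \in m2_cosets)); last by rewrite if_same.
by case/imsetP=> a _ ->; case: rcosetsP => // -[]; exists a; rewrite ?inE.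
Qed.

(** The dominator x of some element of C lies in C, and -x, being neither x nor
    adjacent to x, is dominated by another element of C. *)
Lemma dominating_nz_coset a D :
    dominating (sum_graph_nz H) D -> (H :* a)%g \in m2_cosets ->
  (2 <= #|D :&: (H :* a)%g|)%N.
Proof.
move=> domD; rewrite mem_m2_cosets addcoset_oppE => /andP[/eqP Na noinv].
have dom y : y \in (H :* a)%g ->
    exists2 x, x \in D :&: (H :* a)%g & (y == x) || sum_graph_nz H x y.
  move=> ya; have /dominatingP/(_ y)[x xD xy] := domD; exists x => //.
  rewrite inE xD /=; case/predU1P: xy => [<- // | /sum_graph_nz_sub xyH].
  by rewrite Na -(addcoset_opp_congr (rcoset_eqP ya)) mem_addcoset opprK.
have [x xDa _] := dom a (rcoset_refl _ _).
have /setIP[_ xa] := xDa.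
have [|z zDa xz] := dom (- x); first by rewrite -mem_addcoset_opp -Na.
apply/card_gt1P; exists x, z; split=> //; apply: contraTneq xz => <-.
rewrite /sum_graph_nz subrr !inE eqxx andbF orbF.
apply: contra noinv => /eqP Nx; apply/existsP; exists x.
by rewrite xa mulr2n -{1}Nx addNr eqxx.
Qed.

(** * Dominating sets of minimal size *)

Lemma dominating_repr :
  dominating (sum_graph H) [set repr C | C in rcosets H [set: G]].
Proof.
apply/dominatingP=> y; exists (repr (H :* (- y))%g).
  by apply: imset_f; apply/rcosetsP; exists (- y); rewrite ?inE.
have := mem_repr_rcoset H (- y); set x := repr _.
rewrite mem_addcoset opprK /sum_graph => ->.
by rewrite andbT eq_sym; case: eqP.
Qed.

(** The set C :|: -C, for C the coset of a. *)
Definition sym_coset a : {set G} := (H :* a)%g :|: (H :* (- a))%g.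

(** An element of C :|: -C that only depends on this set, and a solution of
    2x = 0 whenever the set contains one. *)
Definition sym_repr a : G :=
  odflt (repr (sym_coset a)) [pick x in sym_coset a | x *+ 2 == 0].

Definition sym_reprs : {set G} :=
  [set x | (x == sym_repr x) || (- x == sym_repr x)].

Lemma sym_coset_eq a x : x \in sym_coset a -> sym_coset x = sym_coset a.
Proof.
rewrite /sym_coset => /setUP[/rcoset_eqP eqa | /rcoset_eqP eqNa].
  by rewrite (addcoset_opp_congr eqa) eqa.
by rewrite (addcoset_opp_congr eqNa) eqNa opprK setUC.
Qed.

Lemma sym_repr_eq a x : x \in sym_coset a -> sym_repr x = sym_repr a.
Proof. by rewrite /sym_repr => /sym_coset_eq->. Qed.

Lemma sym_coset_refl a : a \in sym_coset a.
Proof. by rewrite inE rcoset_refl. Qed.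

Lemma mem_sym_repr a : sym_repr a \in sym_coset a.
Proof.
rewrite /sym_repr; case: pickP => [x /andP[] // | _].
exact: mem_repr (sym_coset_refl a).
Qed.

Lemma sym_repr_involution a x :
  x \in sym_coset a -> x *+ 2 = 0 -> sym_repr a *+ 2 = 0.
Proof.
move=> xa x2; rewrite /sym_repr.
by case: pickP => [y /andP[_ /eqP] // | /(_ x)]; rewrite xa x2 eqxx.
Qed.

Lemma sym_coset_opp a : sym_coset (- a) = sym_coset a.
Proof. by rewrite /sym_coset opprK setUC. Qed.

Lemma sym_reprs_opp x : (- x \in sym_reprs) = (x \in sym_reprs).
Proof. by rewrite !inE /sym_repr sym_coset_opp opprK orbC. Qed.

Lemma sym_repr_in a : sym_repr a \in sym_reprs.
Proof. by rewrite inE (sym_repr_eq (mem_sym_repr a)) eqxx. Qed.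

Lemma dominating_sym_repr : dominating (sum_graph_nz H) sym_reprs.
Proof.
apply/dominatingP=> y.
have [x xD] : exists2 x, x \in sym_reprs & x \in (H :* (- y))%g.
  have /setUP[qy | qNy] := mem_sym_repr y; last first.
    by exists (sym_repr y); rewrite ?sym_repr_in.
  exists (- sym_repr y); first by rewrite sym_reprs_opp sym_repr_in.
  by rewrite mem_addcoset_opp opprK.
rewrite mem_addcoset opprK => xyH.
have [xy0 | xy0] := eqVneq (x + y) 0.
  exists y; last by rewrite eqxx.
  by rewrite -(addr0_eq xy0) sym_reprs_opp.
exists x => //; rewrite /sum_graph_nz !inE xy0 xyH andbT eq_sym.
by case: eqP.
Qed.

Lemma card_sym_repr_coset a :
  (#|sym_reprs :&: (H :* a)%g| <= 1 + ((H :* a)%g \in m2_cosets))%N.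
Proof.
have reprD x : x \in sym_reprs :&: (H :* a)%g ->
    [/\ x \in (H :* a)%g & x = sym_repr a \/ x = - sym_repr a].
  rewrite !inE => /andP[xD xa]; split=> //.
  rewrite (@sym_repr_eq a x) ?inE ?xa // in xD.
  by case/orP: xD => /eqP <-; [left | right; rewrite opprK].
case: (boolP (_ \in m2_cosets)) => [_ | notm2].
  apply: leq_trans (_ : #|[set sym_repr a; - sym_repr a]| <= 2)%N.
    apply/subset_leq_card/subsetP=> x /reprD[_ [|] ->];
    by rewrite !inE eqxx ?orbT.
  by rewrite cards2; case: eqP.
(* Two distinct elements would be q and -q, so that C = -C; as C is not counted
   by m2 it contains a solution of 2x = 0, whence 2q = 0 and q = -q. *)
have Nq : sym_repr a \in (H :* a)%g -> - sym_repr a \in (H :* a)%g ->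
    - sym_repr a = sym_repr a.
  move=> qa; rewrite -mem_addcoset_opp => /rcoset_eqP; rewrite (rcoset_eqP qa).
  move/eqP; rewrite -addcoset_oppE => a2H.
  move: notm2; rewrite mem_m2_cosets a2H negbK => /existsP[x /andP[xa /eqP x2]].
  have := @sym_repr_involution a x _ x2; rewrite inE xa mulr2n => /(_ isT).
  by move/addr0_eq.
rewrite addn0; apply/card_le1_eqP=> x y /reprD[xa xq] /reprD[ya yq].
by case: xq yq xa ya => -> [] -> // qa q'a; rewrite Nq.
Qed.

End Cosets.

(** * The domination numbers *)

Theorem mainTheorem9 (G : finZmodType) (H : {group G})
    (hH : (1 < #|H| < #|[set: G]|)%N) :
  domination_number (sum_graph H) = #|[set: G] : H|%g /\
  domination_number (sum_graph_nz H) = (#|[set: G] : H|%g + m2 H)%N.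
Proof.
have [H_gt1 _] := andP hH; split.
  apply: (domination_number_eq (dominating_repr H)) => [|D domD].
    exact: leq_imset_card.
  rewrite -[leqLHS]sum1_card; apply: (weight_le_card (w := fun=> 1%N)) => a.
  exact: dominating_two (@sum_graph_sub G H) domD a H_gt1.
rewrite -sum_m2_weight.
apply: (domination_number_eq (dominating_sym_repr H)) => [|D domD].
  rewrite (card_addcosets H); apply: leq_sum => _ /rcosetsP[a _ ->].
  exact: card_sym_repr_coset.
apply: (weight_le_card (w := fun C => 1 + (C \in m2_cosets H))%N) => a.
case: (boolP (_ \in _)) => [am2 | _]; last first.
  exact: dominating_two (@sum_graph_nz_sub G H) domD a H_gt1.
have := am2; rewrite mem_m2_cosets addcoset_oppE => /andP[/eqP<- _].
by have le2 := dominating_nz_coset domD am2; rewrite (leq_add le2 le2).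
Qed.
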